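(* Let $(X,d)$ be a metric space and $f:X\to X$ a continuous map. If $(X,f)$ is mixing, then it is strongly multi-$\beta$-$n$-sensitive with respect to $\alpha$, i.e. for every $n\in\mathbb{N}$ with $n\geq2$ and all $\beta,\alpha\in\mathbb{N}^n$, $(X,f)$ is multi-$\beta$-$n$-sensitive with respect to $\alpha$.
   Context: $\mathbb{N}=\{1,2,3,\dots\}$. - $(X,f)$ is mixing if for all nonempty open $U,V\subseteq X$ there is $N\in\mathbb{N}$ such that $f^k(U)\cap V\neq\emptyset$ for all $k\geq N$. - For a continuous map $g:X\to X$, $\beta=(b_1,\dots,b_n)\in\mathbb{N}^n$, $U\subseteq X$, $\delta>0$, let $N_g(U,\beta,\delta)=\{k\in\mathbb{N}:\exists x_1,\dots,x_n\in U \text{ with } \min_{1\leq i<j\leq n}d(g^{b_ik}(x_i),g^{b_jk}(x_j))>\delta\}$. - For $\beta=(b_1,\dots,b_n)$ and $\alpha=(a_1,\dots,a_n)$ in $\mathbb{N}^n$, $(X,f)$ is multi-$\beta$-$n$-sensitive with respect to $\alpha$ if there is $\delta>0$ such that for every $m\in\mathbb{N}$ with $m\leq n$ and all nonempty open $U_1,\dots,U_m\subseteq X$, $\bigcap_{i=1}^mN_{f^{a_i}}(U_i,\beta,\delta)\neq\emptyset$.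
   Formalization: The formal theorem additionally assumes that X is not a one-point space; on a one-point space the identity is mixing, but all distances are 0, so the sensitivity conclusion fails for every n ≥ 2. *)

(* Defs.v *)
From HB Require Import structures.
From mathcomp Require Import all_boot all_order all_algebra.
From mathcomp Require Import all_classical all_reals all_analysis.

Set Implicit Arguments.
Unset Strict Implicit.
Unset Printing Implicit Defensive.

Import Order.TTheory GRing.Theory Num.Theory.
Import numFieldTopology.Exports.

Local Open Scope classical_set_scope.
Local Open Scope ring_scope.

(* The positive integers are rendered as elements of nat with an explicit
   positivity condition, and n-tuples (b_1, ..., b_n) as functions on 'I_n, so
   that b_(i+1) is b i. *)

Definition mixing (X : topologicalType) (f : X -> X) : Prop :=
  forall U V : set X, open U -> U !=set0 -> open V -> V !=set0 ->
  exists N : nat, (0 < N)%N /\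
    forall k : nat, (N <= k)%N -> (iter k f @` U) `&` V !=set0.

(* The minimum is taken in the extended reals, where +oo is the neutral element
   of Order.min; for n >= 2 it is the minimum of a nonempty finite family of
   real numbers. *)
Definition separation_times (R : realType) (X : metricType R) (g : X -> X)
    (n : nat) (U : set X) (b : 'I_n -> nat) (delta : R) : set nat :=
  [set k : nat | (0 < k)%N /\
    exists x : 'I_n -> X, (forall i, U (x i)) /\
      (delta%:E <
       \big[Order.min/+oo]_(p : 'I_n * 'I_n | (p.1 < p.2)%N)
         (mdist (iter (b p.1 * k) g (x p.1))
                (iter (b p.2 * k) g (x p.2)))%:E)%E].

Definition multi_sensitive (R : realType) (X : metricType R) (f : X -> X)
    (n : nat) (b a : 'I_n -> nat) : Prop :=
  exists delta : R, 0 < delta /\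
    forall (m : nat) (le_mn : (m <= n)%N), (0 < m)%N ->
    forall U : 'I_m -> set X, (forall i, open (U i) /\ U i !=set0) ->
    \bigcap_(i in [set: 'I_m])
      separation_times (iter (a (widen_ord le_mn i)) f) (U i) b delta !=set0.

(* This never holds on a one-point space, although the identity of a one-point
   space is mixing; results deducing it from mixing must exclude that case. *)
Definition strongly_multi_sensitive (R : realType) (X : metricType R)
    (f : X -> X) : Prop :=
  forall n : nat, (2 <= n)%N ->
  forall b a : 'I_n -> nat,
    (forall i, (0 < b i)%N) -> (forall i, (0 < a i)%N) ->
  multi_sensitive f b a.

(* Main.v *)
Require Import Defs.
From HB Require Import structures.
From mathcomp Require Import all_boot all_order all_algebra.
From mathcomp Require Import all_classical all_reals all_analysis.
From mathcomp Require Import lra.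

Set Implicit Arguments.
Unset Strict Implicit.
Unset Printing Implicit Defensive.

Import Order.TTheory GRing.Theory Num.Theory.
Import numFieldTopology.Exports.

Local Open Scope classical_set_scope.
Local Open Scope ring_scope.

(** A finite T1 space is discrete, and a discrete mixing space has at most one
    point; hence [X] is infinite. Pick [n] distinct points and balls around them
    whose radius [delta] is at most a third of their mutual distances, so that
    points of different balls are more than [delta] apart. Mixing gives a [K]
    such that all iterates of [f] of order at least [K] send every [U_i] onto a
    set meeting every ball; since [a_i b_j K >= K], the time [K] is a common
    separation time. *)

Lemma mixing_infinite (X : topologicalType) (f : X -> X) (x y : X) :
  accessible_space X -> x != y -> mixing f -> infinite_set [set: X].
Proof.
move=> T1 xy mix finX.
have open1 (z : X) : open [set z].
  move/accessible_finite_set_closed: T1 => fin_closed.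
  rewrite -[[set z]]setCK openC; apply: fin_closed.
  exact: sub_finite_set finX.
have return_time z w := mix _ _ (open1 z) (ex_intro _ z erefl)
                                (open1 w) (ex_intro _ w erefl).
have [[N [_ Nxx]] [M [_ Mxy]]] := (return_time x x, return_time x y).
(* At the common time [maxn N M] the iterate of [f] sends [x] both to [x] and to [y]. *)
have [_ [[_ -> <-] /= fx]] := Nxx (maxn N M) (leq_maxl _ _).
have [_ [[_ -> <-] /= fy]] := Mxy (maxn N M) (leq_maxr _ _).
by move: xy; rewrite -fx fy eqxx.
Qed.

Lemma infinite_set_injection (T : Type) :
  infinite_set [set: T] -> exists y : nat -> T, injective y.
Proof.
elim/Ppointed: T => T; first by rewrite emptyE => /(_ (finite_set0 _)).
move=> /infiniteP/pcard_injP[y y_inj]; exists y => i j.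
by apply: y_inj; rewrite inE.
Qed.

(** By the triangle inequality, 3 [delta] <= d(y_i, y_j) < 2 [delta] + d(u, v). *)
Lemma separated_points (R : realType) (X : metricType R) (n : nat)
    (y : 'I_n -> X) : injective y ->
  exists2 delta : R, 0 < delta &
    forall (i j : 'I_n) (u v : X), i != j ->
      ball (y i) delta u -> ball (y j) delta v -> delta < mdist u v.
Proof.
move=> y_inj.
(* The default value 1 keeps [delta] positive when there is no pair of distinct indices. *)
pose delta : R :=
  \big[Order.min/1]_(p : 'I_n * 'I_n | p.1 != p.2) (mdist (y p.1) (y p.2) / 3).
exists delta.
  apply: lt_bigmin => // -[i j] /= ij.
  by rewrite divr_gt0// mdist_gt0 (inj_eq y_inj).
move=> i j u v ij; rewrite !ballEmdist /= => yu yv.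
have : delta <= mdist (y i) (y j) / 3 by exact: (@bigmin_le_cond _ _ _ _ (i, j)).
have := metric_triangle (y i) u (y j); have := metric_triangle u v (y j).
by rewrite (metric_sym v (y j)); lra.
Qed.

(** There are finitely many pairs (U_i, V_j), so the maximum of their mixing times serves all; the
    successor makes it positive. *)
Lemma mixing_common_time (X : topologicalType) (f : X -> X) (I J : finType)
    (U : I -> set X) (V : J -> set X) :
  mixing f -> (forall i, open (U i) /\ U i !=set0) ->
  (forall j, open (V j) /\ V j !=set0) ->
  exists2 K : nat, (0 < K)%N & forall i j k, (K <= k)%N ->
    (iter k f @` U i) `&` V j !=set0.
Proof.
move=> mix Uo Vo.
have /choice[N NP] (p : I * J) : exists N : nat, forall k, (N <= k)%N ->
    (iter k f @` U p.1) `&` V p.2 !=set0.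
  have [oU U0] := Uo p.1; have [oV V0] := Vo p.2.
  by have [N [_ NP]] := mix _ _ oU U0 oV V0; exists N.
exists (\max_p N p).+1 => // i j k Kk; apply: (NP (i, j)).
by apply: leq_trans (ltnW Kk); exact: leq_bigmax.
Qed.

Theorem theorem13 (R : realType) (X : metricType R) (f : X -> X)
    (X_not_one_point : ~ (exists x : X, [set: X] = [set x]))
    (f_continuous : continuous f) :
  mixing f -> strongly_multi_sensitive f.
Proof.
move=> mix n _ b a b_gt0 a_gt0.
have [[x0 _]|X0] := pselect ([set: X] !=set0); last first.
  (* In an empty space any [delta] works: as [m] > 0, some U_i would have to be nonempty. *)
  exists 1; split=> // m le_mn m_gt0 U Uo.
  by have [_ [x _]] := Uo (Ordinal m_gt0); case: X0; exists x.
have [x1 x01] : exists x1, x0 != x1.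
  apply: contra_notP X_not_one_point => /forallNP x0_only; exists x0.
  by apply/seteqP; split=> // x _; have /negP/negPn/eqP-> := x0_only x.
have T1 := hausdorff_accessible (@metric_hausdorff _ X).
have [y y_inj] := infinite_set_injection (mixing_infinite T1 x01 mix).
have [delta delta_gt0 sep] :=
  separated_points (inj_comp y_inj (@ord_inj n)) (R := R).
exists delta; split=> // m le_mn _ U Uo.
pose V (j : 'I_n) := (ball (y j) delta)°.
have Vo j : open (V j) /\ V j !=set0.
  have [oV Vy] := open_nbhs_ball (y j) (PosNum delta_gt0).
  by split=> //; exists (y j).
have [K K_gt0 KP] := mixing_common_time mix Uo Vo.
exists K => i _; split=> //.
have /choice[x xP] (j : 'I_n) : exists x, U i x /\
    V j (iter (b j * K) (iter (a (widen_ord le_mn i)) f) x).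
  (* Iterating f^{a_i} b_j K times amounts to b_j K a_i steps of [f]. *)
  have K_le : (K <= b j * K * a (widen_ord le_mn i))%N.
    by rewrite mulnAC leq_pmull// muln_gt0 b_gt0 a_gt0.
  have [_ [[x Ux <-] Vx]] := KP i j _ K_le.
  by exists x; split=> //; rewrite -iterM.
exists x; split=> [j|]; first by have [] := xP j.
(* The neutral value [+oo] of the minimum must exceed [delta] as well. *)
apply: lt_bigmin => [|[j1 j2] /= j12]; first exact: ltry.
have [[_ V1] [_ V2]] := (xP j1, xP j2).
rewrite lte_fin; apply: (sep j1 j2); [by rewrite neq_ltn j12|..];
  exact: interior_subset.
Qed.
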